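(* There exists a series-parallel graph of maximum degree $5$ that is not outer-RAC.
   Context: A series-parallel (SP-) graph is a biconnected graph whose SPQR-tree contains no $R$-nodes (equivalently, a biconnected graph with no subdivision of $K_4$). A drawing is straight-line if each edge is a line segment; an outer-RAC drawing is a straight-line drawing in which every crossing occurs at a right angle and every vertex is incident to the unbounded cell of the plane minus the drawing. A graph is outer-RAC if it admits an outer-RAC drawing. *)

(* Defs.v *)
From HB Require Import structures.
From mathcomp Require Import all_boot all_order all_algebra.
From mathcomp Require Import all_classical all_reals all_analysis.

Set Implicit Arguments.
Unset Strict Implicit.
Unset Printing Implicit Defensive.

Import Order.TTheory GRing.Theory Num.Theory.
Import numFieldNormedType.Exports.

Local Open Scope classical_set_scope.
Local Open Scope ring_scope.

Record sgraph := SGraph {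
  vertex :> finType;
  adj : rel vertex;
  adj_sym : symmetric adj;
  adj_irrefl : irreflexive adj }.

Section Graphs.
Variable G : sgraph.

Definition degree (v : G) : nat := #|[pred w | adj v w]|.

Definition max_degree : nat := \max_(v : G) degree v.

Definition avoiding (c : G) : rel G :=
  [rel x y | [&& x != c, y != c & adj x y]].

Definition biconnected : Prop :=
  [/\ (2 < #|G|)%N,
      forall u v : G, connect (@adj G) u v
    & forall c u v : G, u != c -> v != c -> connect (avoiding c) u v].

(* [b] lists the branch vertices and, for i < j, [p i j] the inner vertices of
   the path that replaces the edge ij of K_4; [p i j] is unused for j <= i. *)
Definition has_K4_subdivision : Prop :=
  exists (b : 'I_4 -> G) (p : 'I_4 -> 'I_4 -> seq G),
    [/\ injective b,
        forall i j : 'I_4, (i < j)%N ->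
          path (@adj G) (b i) (rcons (p i j) (b j)) /\ uniq (p i j),
        forall i j k : 'I_4, (i < j)%N -> b k \notin p i j
      & forall i j k l : 'I_4, (i < j)%N -> (k < l)%N -> (i, j) != (k, l) ->
          forall x : G, x \in p i j -> x \notin p k l].

Definition series_parallel : Prop := biconnected /\ ~ has_K4_subdivision.

End Graphs.

Section Drawings.
Variables (R : realType) (G : sgraph).

Local Notation plane := (R * R)%type.

Definition segment (a b : plane) : set plane :=
  [set (1 - t) *: a + t *: b | t in `[0, 1]].

Definition open_segment (a b : plane) : set plane :=
  [set (1 - t) *: a + t *: b | t in `]0, 1[].

Definition perpendicular (a b : plane) : Prop := a.1 * b.1 + a.2 * b.2 = 0.

(* A straight-line drawing is determined by the positions of the vertices. No
   edge passes through a vertex other than its ends; this also prevents two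
   edges from overlapping in more than one point. *)
Definition straight_line_drawing (f : G -> plane) : Prop :=
  injective f /\
  forall u v w : G, adj u v -> w != u -> w != v -> ~ segment (f u) (f v) (f w).

Definition right_angle_crossings (f : G -> plane) : Prop :=
  forall u v x y : G, adj u v -> adj x y -> [set u; v]%SET != [set x; y]%SET ->
    open_segment (f u) (f v) `&` open_segment (f x) (f y) !=set0 ->
    perpendicular (f v - f u) (f y - f x).

Definition drawn_points (f : G -> plane) : set plane :=
  [set p | (exists v : G, p = f v) \/
           (exists u v : G, adj u v /\ segment (f u) (f v) p)].

(* The complement of the bounded set [drawn_points f] has exactly one unbounded
   connected component. *)
Definition unbounded_cell (f : G -> plane) : set plane :=
  [set p | (~` drawn_points f) p /\
           ~ bounded_set (connected_component (~` drawn_points f) p)].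

Definition outer_RAC_drawing (f : G -> plane) : Prop :=
  [/\ straight_line_drawing f, right_angle_crossings f
    & forall v : G, closure (unbounded_cell f) (f v)].

Definition outer_RAC : Prop := exists f : G -> plane, outer_RAC_drawing f.

End Drawings.

(* Main.v *)
Require Import Defs.
From mathcomp Require Import all_boot all_order all_algebra.
From mathcomp Require Import all_classical all_reals all_analysis.
From mathcomp Require Import ring lra.

(* K_{2,5} works: in an outer-RAC drawing, two vertices a, b have at most four
   common neighbours.  Put a = (0, 0), b = (1, 0) and describe a vertex i off
   the line ab by the cotangents u_i, w_i of the angles of the triangle a b i
   at a and b.  Two common neighbours i, j on the same side of ab are either
   nested (u_i < u_j and w_i < w_j: j lies in the triangle a b i) or crossing
   (u_i < u_j and w_i > w_j: the edges aj and bi meet), and in the latter case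
   the right angle means u_j w_i = 1.  Hence there is no chain of three crossing
   vertices, and no chain of three nested ones, since the middle one would be
   enclosed by a quadrilateral.  As in the Erdos-Szekeres theorem, one side of
   ab holds at most four common neighbours.  If some common neighbour is not
   strictly on this side, a nested pair on it is impossible as well, again by
   enclosure, and the side holds at most two.  Finally at most one common
   neighbour lies on ab, and then one of the two sides is empty. *)

Set Implicit Arguments.
Unset Strict Implicit.
Unset Printing Implicit Defensive.

Import Order.TTheory GRing.Theory Num.Theory.
Import numFieldNormedType.Exports.

(** * Branch vertices of a subdivision of K_4 *)

(** The three paths that leave [b k] start with three different neighbours: a coincidence would put
    one vertex on two paths, or a branch vertex inside a path. *)
Lemma K4_subdivision_degree (G : sgraph) : has_K4_subdivision G ->
  exists2 b : 'I_4 -> G, injective b & forall k, (2 < degree (b k))%N.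
Proof.
move=> [b [p [b_inj p_path p_branch p_disj]]]; exists b => // k.
(* [n m] is the neighbour of [b k] on the path towards [b m]. Only paths with increasing indices
   count, so for m < k it is the last inner vertex; the default [b m] serves a path without inner
   vertices. *)
pose n (m : 'I_4) : G := if (k < m)%N then head (b m) (p k m) else last (b m) (p m k).
have ltN m : m != k -> ~~ (k < m)%N -> (m < k)%N.
  by move=> mk; rewrite -leqNgt leq_eqVlt => /orP[/eqP/val_inj e|//]; rewrite e eqxx in mk.
have n_adj m : m != k -> adj (b k) (n m).
  move=> mk; rewrite /n; case: ifPn => [km|/(ltN _ mk) km].
    by have [+ _] := p_path _ _ km; case: (p k m) => [|x s] /= /andP[].
  by have [+ _] := p_path _ _ km; rewrite rcons_path => /andP[_]; rewrite adj_sym.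
have n_cases m : m != k -> n m = b m \/
    n m \in (if (k < m)%N then p k m else p m k).
  move=> mk; rewrite /n; case: ifPn => km.
    by case: (p k m) => [|x s]; [left|right; rewrite inE eqxx].
  by case/lastP: (p m k) => [|s x]; [left|right; rewrite last_rcons mem_rcons inE eqxx].
have branchN m l : m != k -> b l \notin (if (k < m)%N then p k m else p m k).
  by move=> mk; case: ifPn => [km|/(ltN _ mk) km]; exact: p_branch.
have n_inj : {in predC1 k &, injective n}.
  move=> m m' mk m'k e; apply: contrapT => /eqP mm'.
  case: (n_cases _ mk) (n_cases _ m'k) => [em|nm] [em'|nm'].
  - by move: e; rewrite em em' => /b_inj/eqP; apply/negP.
  - by move: nm'; rewrite -e em (negbTE (branchN _ _ m'k)).
  - by move: nm; rewrite e em' (negbTE (branchN _ _ mk)).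
  move: nm nm'; rewrite e; case: ifPn => [km|/(ltN _ mk) km];
    case: ifPn => [km'|/(ltN _ m'k) km'] h; apply/negP; apply: p_disj h => //;
    rewrite xpair_eqE negb_and ?mm' ?orbT//.
  - by rewrite eq_sym (m'k : m' != k).
  - by rewrite (mk : m != k).
have <- : #|predC1 k| = 3%N by rewrite cardC1 card_ord.
rewrite -(card_in_image n_inj); apply/subset_leq_card/fintype.subsetP => x.
by case/fintype.imageP=> m mk ->; rewrite inE; exact: n_adj.
Qed.

Section Drawings.
Local Open Scope classical_set_scope.
Local Open Scope ring_scope.

Lemma divr_gt0_mul (R : realFieldType) (x y : R) : 0 < x * y -> 0 < x / y.
Proof.
move=> xy; have /norP[_ y0] : ~~ ((x == 0) || (y == 0)) by rewrite -mulf_eq0 gt_eqF.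
by rewrite -(pmulr_lgt0 _ (_ : 0 < y ^+ 2)) ?exprn_even_gt0// expr2 mulrA divfK.
Qed.

Lemma divr_lt0_mul (R : realFieldType) (x y : R) : x * y < 0 -> x / y < 0.
Proof. by rewrite -oppr_gt0 -mulNr => /divr_gt0_mul; rewrite mulNr oppr_gt0. Qed.

(** * Enclosed vertices and the unbounded cell *)

Section Topology.
Variables (R : realType) (G : sgraph) (f : G -> R * R).

(** Suppose the unbounded cell met [U] at q. The component K of q avoids the drawing, so K meets [U]
    and [C] in the same set, which is open and closed in K and hence all of K. Then K lies in the
    bounded set [C]. *)
Lemma enclosed_not_outer (U C : set (R * R)) (v : G) :
  open U -> closed C -> U `<=` C -> C `<=` U `|` drawn_points f ->
  bounded_set C -> U (f v) -> ~ closure (unbounded_cell f) (f v).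
Proof.
move=> oU cC UC CUD bC Ufv /(_ U (open_nbhs_nbhs (conj oU Ufv))).
move=> [q [[Dq unb] Uq]]; apply: unb.
set K := connected_component _ q.
have Kq : K q by exact: connected_component_refl.
have KD : K `<=` ~` drawn_points f by exact: connected_component_sub.
have KUC : K `&` U = K `&` C.
  apply/seteqP; split=> [p [Kp /UC]//|p [Kp /CUD[]//]].
  by move/(KD _ Kp).
have KU : K `&` U = K.
  apply: (component_connected (A := ~` drawn_points f) (x := q)).
  - by exists q.
  - by exists U.
  - by exists C.
have KC : K `<=` C by rewrite -KU KUC; exact: subIsetr.
by move: bC; apply: (@filterS _ (pinfty_nbhs R)) => M bM p /KC; exact: bM.
Qed.

Lemma open_gt0 (h : R * R -> R) : continuous h -> open [set p | 0 < h p].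
Proof.
move=> ch; apply: (@open_comp _ _ h [set x | 0 < x]) => [p _|]; first exact: ch.
exact: open_gt.
Qed.

Lemma closed_ge0 (h : R * R -> R) : continuous h -> closed [set p | 0 <= h p].
Proof.
move=> /continuous_closedP ch.
exact: (ch [set x | 0 <= x] (@closed_ge _ 0)).
Qed.

End Topology.

(** * The frame in which ab is the unit base *)

Section Coordinates.
Variables (R : realType) (a b : R * R).
Hypothesis neq_ab : a <> b.

Let d1 := b.1 - a.1.
Let d2 := b.2 - a.2.
Let L := d1 ^+ 2 + d2 ^+ 2.

(* The coordinates of the frame in which a = (0, 0) and b = (1, 0). *)
Definition xcoord (p : R * R) : R :=
  ((p.1 - a.1) * d1 + (p.2 - a.2) * d2) / L.

Definition ycoord (p : R * R) : R :=
  ((p.2 - a.2) * d1 - (p.1 - a.1) * d2) / L.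

Let Lneq0 : L != 0.
Proof.
rewrite /L paddr_eq0 ?sqr_ge0// !sqrf_eq0 !subr_eq0.
apply/negP => /andP[/eqP e1 /eqP e2]; apply: neq_ab.
by case: a b e1 e2 => ? ? [? ?] /= -> ->.
Qed.

Lemma coordK1 p : p.1 = a.1 + xcoord p * d1 - ycoord p * d2.
Proof. by move: Lneq0; rewrite /xcoord /ycoord /L => ?; field. Qed.

Lemma coordK2 p : p.2 = a.2 + xcoord p * d2 + ycoord p * d1.
Proof. by move: Lneq0; rewrite /xcoord /ycoord /L => ?; field. Qed.

Lemma coord_inj p q : xcoord p = xcoord q -> ycoord p = ycoord q -> p = q.
Proof.
move=> ex ey; rewrite [p]surjective_pairing [q]surjective_pairing.
by rewrite (coordK1 p) (coordK1 q) (coordK2 p) (coordK2 q) ex ey.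
Qed.

Lemma xcoord_comb t p q :
  xcoord ((1 - t) *: p + t *: q) = (1 - t) * xcoord p + t * xcoord q.
Proof. by move: Lneq0; rewrite /xcoord /L /= /GRing.scale /= => ?; field. Qed.

Lemma ycoord_comb t p q :
  ycoord ((1 - t) *: p + t *: q) = (1 - t) * ycoord p + t * ycoord q.
Proof. by move: Lneq0; rewrite /ycoord /L /= /GRing.scale /= => ?; field. Qed.

Lemma combE t p q r :
  xcoord r = (1 - t) * xcoord p + t * xcoord q ->
  ycoord r = (1 - t) * ycoord p + t * ycoord q ->
  (1 - t) *: p + t *: q = r.
Proof. by move=> ex ey; apply: coord_inj; rewrite ?xcoord_comb ?ycoord_comb. Qed.

Lemma segment_coord t p q r : 0 <= t <= 1 ->
  xcoord r = (1 - t) * xcoord p + t * xcoord q ->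
  ycoord r = (1 - t) * ycoord p + t * ycoord q ->
  segment p q r.
Proof. by move=> t01 ex ey; exists t; [rewrite /= in_itv | exact: combE]. Qed.

Lemma open_segment_coord t p q r : 0 < t < 1 ->
  xcoord r = (1 - t) * xcoord p + t * xcoord q ->
  ycoord r = (1 - t) * ycoord p + t * ycoord q ->
  open_segment p q r.
Proof. by move=> t01 ex ey; exists t; [rewrite /= in_itv | exact: combE]. Qed.

(** The change of frame is a similarity: it divides inner products by [L]. *)
Lemma perpendicular_coord p q r s : perpendicular (q - p) (s - r) ->
  (xcoord q - xcoord p) * (xcoord s - xcoord r) +
  (ycoord q - ycoord p) * (ycoord s - ycoord r) = 0.
Proof.
rewrite /perpendicular /= => e; apply: (mulfI Lneq0); rewrite mulr0 -[RHS]e.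
rewrite (coordK1 p) (coordK1 q) (coordK1 r) (coordK1 s).
by rewrite (coordK2 p) (coordK2 q) (coordK2 r) (coordK2 s) /L; ring.
Qed.

Lemma xcoord_a : xcoord a = 0. Proof. by rewrite /xcoord !subrr !mul0r addr0 mul0r. Qed.
Lemma ycoord_a : ycoord a = 0. Proof. by rewrite /ycoord !subrr !mul0r subr0 mul0r. Qed.
Lemma xcoord_b : xcoord b = 1.
Proof. by rewrite /xcoord -!expr2 divff. Qed.
Lemma ycoord_b : ycoord b = 0.
Proof. by rewrite /ycoord [X in X - _]mulrC subrr mul0r. Qed.

Lemma xcoord_continuous : continuous xcoord.
Proof.
move=> p; rewrite /xcoord; apply: cvgMl; apply: cvgD; apply: cvgMl; apply: cvgB.
- exact: cvg_fst.
- exact: cvg_cst.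
- exact: cvg_snd.
- exact: cvg_cst.
Qed.

Lemma ycoord_continuous : continuous ycoord.
Proof.
move=> p; rewrite /ycoord; apply: cvgMl; apply: cvgB; apply: cvgMl; apply: cvgB.
- exact: cvg_snd.
- exact: cvg_cst.
- exact: cvg_fst.
- exact: cvg_cst.
Qed.

Lemma coord_bounded (C : set (R * R)) (M : R) :
  (forall p, C p -> `|xcoord p| <= M /\ `|ycoord p| <= M) -> bounded_set C.
Proof.
move=> CM.
exists (Num.max (`|a.1| + M * `|d1| + M * `|d2|) (`|a.2| + M * `|d2| + M * `|d1|)).
split=> [|N /ltW ltN p /CM [xM yM]]; first exact: num_real.
apply: le_trans ltN.
rewrite prod_normE ge_max !le_max; apply/andP; split; apply/orP.
  left; rewrite (coordK1 p) (le_trans (ler_normB _ _))// lerD//.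
    by rewrite (le_trans (ler_normD _ _))// lerD// normrM ler_wpM2r.
  by rewrite normrM ler_wpM2r.
right; rewrite (coordK2 p) (le_trans (ler_normD _ _))// lerD//.
  by rewrite (le_trans (ler_normD _ _))// lerD// normrM ler_wpM2r.
by rewrite normrM ler_wpM2r.
Qed.

End Coordinates.

(** * Triangles over the base ab *)

Section CommonNeighbours.
Variables (R : realType) (G : sgraph) (f : G -> R * R) (a b : G).
Hypothesis f_drawing : outer_RAC_drawing f.
Hypothesis neq_ab : a != b.

Let common := [pred i | adj a i && adj b i].

Local Notation xc := (xcoord (f a) (f b)).
Local Notation yc := (ycoord (f a) (f b)).
Local Notation X i := (xc (f i)).
Local Notation Y i := (yc (f i)).

(** The strict product treats both sides of ab at once and keeps i and j off the line. *)
Let side i j := 0 < Y i * Y j.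

Let H i := `|Y i|.

(* Cotangents of the angles of the triangle a b i at a and at b. *)
Let u i := X i / H i.
Let w i := (1 - X i) / H i.

(* Barycentric coordinates of p with respect to the triangle (f a, f b, f i);
   meaningful only when Y i != 0. *)
Let bary_apex i p := yc p / Y i.
Let bary_b i p := xc p - X i * bary_apex i p.
Let bary_a i p := 1 - bary_apex i p - bary_b i p.

Let tri i : set (R * R) :=
  [set p | [/\ 0 <= bary_apex i p, 0 <= bary_b i p & 0 <= bary_a i p]].

Let f_inj : injective f. Proof. by case: f_drawing => -[]. Qed.

Let neq_fab : f a <> f b.
Proof. by move/f_inj/eqP; apply/negP. Qed.

Let off_edge (i j v : G) : adj i j -> v != i -> v != j -> ~ segment (f i) (f j) (f v).
Proof. by case: f_drawing => -[_ h] _ _; exact: h. Qed.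

Let not_outer (U C : set (R * R)) v :
  open U -> closed C -> U `<=` C -> C `<=` U `|` drawn_points f ->
  bounded_set C -> ~ U (f v).
Proof.
move=> oU cC UC CD bC Uv; case: f_drawing => _ _ /(_ v).
exact: (enclosed_not_outer oU cC UC CD bC Uv).
Qed.

Let neq_adj (i j : G) : adj i j -> i != j.
Proof. by apply: contraTN => /eqP ->; rewrite adj_irrefl. Qed.

Let Xa : X a = 0. Proof. exact: xcoord_a. Qed.
Let Ya : Y a = 0. Proof. exact: ycoord_a. Qed.
Let Xb : X b = 1. Proof. exact: xcoord_b. Qed.
Let Yb : Y b = 0. Proof. exact: ycoord_b. Qed.

Let segment_a i p t : 0 <= t <= 1 -> xc p = t * X i -> yc p = t * Y i ->
  segment (f a) (f i) p.
Proof.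
by move=> t01 ex ey; apply: (segment_coord neq_fab t01); rewrite (Xa, Ya) mulr0 add0r.
Qed.

Let segment_b i p t : 0 <= t <= 1 -> xc p = 1 - t + t * X i -> yc p = t * Y i ->
  segment (f b) (f i) p.
Proof.
move=> t01 ex ey; apply: (segment_coord neq_fab t01).
  by rewrite Xb mulr1.
by rewrite Yb mulr0 add0r.
Qed.

Let drawn_edge (i j : G) p : adj i j -> segment (f i) (f j) p -> drawn_points f p.
Proof. by move=> ij ijp; right; exists i, j. Qed.

(** These two sides of the triangle lie on the edges ai and bi. The base is left out, as a and b
    need not be adjacent. *)
Let tri_edge i p : i \in common -> Y i != 0 -> tri i p ->
  bary_b i p = 0 \/ bary_a i p = 0 -> drawn_points f p.
Proof.
move=> /andP[ai bi] Yi0 [hc hb ha] h.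
have t01 : 0 <= bary_apex i p <= 1 by rewrite hc/=; move: ha hb; rewrite /bary_a; lra.
have ey : yc p = bary_apex i p * Y i by rewrite /bary_apex divfK.
case: h => h.
  apply: (drawn_edge ai); apply: (segment_a t01) => //.
  by move: h; rewrite /bary_b; lra.
apply: (drawn_edge bi); apply: (segment_b t01) => //.
by move: h; rewrite /bary_a /bary_b; lra.
Qed.

Let tri_bounded i p : Y i != 0 -> tri i p ->
  `|xc p| <= 1 + `|X i| + `|Y i| /\ `|yc p| <= 1 + `|X i| + `|Y i|.
Proof.
move=> Yi0 [hc hb ha].
have c1 : bary_apex i p <= 1 by move: ha hb; rewrite /bary_a; lra.
have b1 : bary_b i p <= 1 by move: ha hc; rewrite /bary_a; lra.
have ey : yc p = bary_apex i p * Y i by rewrite /bary_apex divfK.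
have ex : xc p = bary_b i p + bary_apex i p * X i by rewrite /bary_b; ring.
have nX := normr_ge0 (X i); have nY := normr_ge0 (Y i).
have hX : bary_apex i p * `|X i| <= `|X i| by rewrite ler_piMl.
have hY : bary_apex i p * `|Y i| <= `|Y i| by rewrite ler_piMl.
rewrite ey ex; split.
  rewrite (le_trans (ler_normD _ _))// normrM (ger0_norm hb) (ger0_norm hc).
  lra.
by rewrite normrM (ger0_norm hc); lra.
Qed.

Let bary_apex_continuous i : continuous (bary_apex i).
Proof. by move=> p; apply: cvgMl; exact: ycoord_continuous. Qed.

Let bary_b_continuous i : continuous (bary_b i).
Proof.
move=> p; apply: cvgB; first exact: xcoord_continuous.
by apply: cvgMr; exact: bary_apex_continuous.
Qed.

Let bary_a_continuous i : continuous (bary_a i).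
Proof.
move=> p; apply: cvgB; last exact: bary_b_continuous.
by apply: cvgB; [exact: cvg_cst|exact: bary_apex_continuous].
Qed.

Let oppf_continuous (h : R * R -> R) : continuous h -> continuous (fun p => - h p).
Proof. by move=> ch p; apply: cvgN; exact: ch. Qed.

Let open_bary_ary_apex i := open_gt0 (@bary_apex_continuous i).
Let open_bary_ary_b i := open_gt0 (@bary_b_continuous i).
Let open_bary_a i := open_gt0 (@bary_a_continuous i).
Let open_bary_ary_apexN i := open_gt0 (oppf_continuous (@bary_apex_continuous i)).
Let open_bary_ary_bN i := open_gt0 (oppf_continuous (@bary_b_continuous i)).
Let open_bary_aN i := open_gt0 (oppf_continuous (@bary_a_continuous i)).

Let tri_closed i : closed (tri i).
Proof.
rewrite (_ : tri i = [set p | 0 <= bary_apex i p] `&` [set p | 0 <= bary_b i p]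
  `&` [set p | 0 <= bary_a i p]); last first.
  by apply/seteqP; split=> [p []|p [[]]].
apply: closedI; last exact: (closed_ge0 (@bary_a_continuous i)).
apply: closedI; first exact: (closed_ge0 (@bary_apex_continuous i)).
exact: (closed_ge0 (@bary_b_continuous i)).
Qed.

(** * Regions enclosed by drawn edges *)

(** On the line ab the coordinates do not depend on the apex, which allows comparing two triangles
    along their base. *)
Let bary_base i k p : Y i != 0 -> bary_apex i p = 0 ->
  [/\ bary_apex k p = 0, bary_b k p = bary_b i p & bary_a k p = bary_a i p].
Proof.
move=> Yi0 /eqP; rewrite /bary_a /bary_b /bary_apex.
rewrite mulf_eq0 invr_eq0 (negbTE Yi0) orbF => /eqP ->.
by rewrite !mul0r !mulr0.
Qed.

Let bary_apex_ratio i k p : Y i != 0 -> Y k != 0 ->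
  bary_apex k p = bary_apex i p * (Y i / Y k).
Proof. by move=> Yi0 Yk0; rewrite /bary_apex mulrA divfK. Qed.

(** The triangles of i and k lie on opposite sides of ab and form the quadrilateral a i b k, all of
    whose sides are drawn. The two disjunctions say that v is in its interior. *)
Lemma opposite_enclosed i k v :
  i \in common -> k \in common -> Y i * Y k < 0 ->
  ~ ((bary_apex i (f v) < 0 \/ 0 < bary_b i (f v) /\ 0 < bary_a i (f v)) /\
     (bary_apex k (f v) < 0 \/ 0 < bary_b k (f v) /\ 0 < bary_a k (f v))).
Proof.
move=> ci ck ik_lt0 Uv.
have /norP[Yi0 Yk0] : ~~ ((Y i == 0) || (Y k == 0)) by rewrite -mulf_eq0 lt_eqF.
(* The open cone at i through the base, together with the open half-plane beyond ab. The
   intersection of the two wedges is open and contains the open segment ab, which the two open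
   triangles would miss. *)
pose wedge i := [set p | 0 < - bary_apex i p] `|`
  ([set p | 0 < bary_b i p] `&` [set p | 0 < bary_a i p]).
have apex_sign i' k' p : Y i' * Y k' < 0 -> 0 < bary_apex i' p -> bary_apex k' p < 0.
  move=> lt0 hc.
  have /norP[Yi'0 Yk'0] : ~~ ((Y i' == 0) || (Y k' == 0)) by rewrite -mulf_eq0 lt_eqF.
  by rewrite (bary_apex_ratio p Yi'0 Yk'0) pmulr_rlt0// divr_lt0_mul.
have half i' k' p : i' \in common -> Y i' != 0 -> Y i' * Y k' < 0 -> tri i' p ->
    (wedge i' `&` wedge k') p \/ drawn_points f p.
  move=> ci' Yi'0 lt0 Tp; have [hc hb ha] := Tp.
  move: (hb); rewrite le_eqVlt eq_sym => /predU1P[b0|b_gt0].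
    by right; apply: tri_edge Tp _ => //; left.
  move: (ha); rewrite le_eqVlt eq_sym => /predU1P[a0|a_gt0].
    by right; apply: tri_edge Tp _ => //; right.
  left; split; first by right.
  move: (hc); rewrite le_eqVlt eq_sym => /predU1P[c0|c_gt0].
    by have [_ eb ea] := bary_base k' Yi'0 c0; right; rewrite /= eb ea.
  by left; rewrite /= oppr_gt0; exact: apex_sign c_gt0.
apply: (@not_outer (wedge i `&` wedge k) (tri i `|` tri k) v).
- by apply: openI; apply: openU => //; exact: openI.
- by apply: closedU.
- move=> p [Wi Wk].
  have [ci_gt0|ci_lt0|ci0] := ltrgtP 0 (bary_apex i p).
  + by left; case: Wi => [/=|[/= hb ha]]; [rewrite oppr_gt0 ltNge ltW|split; exact: ltW].
  + have ck_gt0 : 0 < bary_apex k p.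
      by rewrite (bary_apex_ratio p Yi0 Yk0) nmulr_rgt0// divr_lt0_mul.
    by right; case: Wk => [/=|[/= hb ha]]; [rewrite oppr_gt0 ltNge ltW|split; exact: ltW].
  + left; case: Wi => [/=|[/= hb ha]]; first by rewrite -ci0 oppr0 ltxx.
    by split; rewrite -?ci0//; exact: ltW.
- move=> p [Tp|Tp]; first exact: (half i k).
  have ki_lt0 : Y k * Y i < 0 by rewrite mulrC.
  by have [[Wk Wi]|Dp] := half k i p ck Yk0 ki_lt0 Tp; [left|right].
- apply: (@coord_bounded _ _ _ neq_fab _
    ((1 + `|X i| + `|Y i|) + (1 + `|X k| + `|Y k|))) => p Tp.
  have := (normr_ge0 (X i), normr_ge0 (Y i), normr_ge0 (X k), normr_ge0 (Y k)).
  by move=> [[[h1 h2] h3] h4]; case: Tp => /tri_bounded [//|ex ey]; split; lra.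
- by rewrite /wedge /= !oppr_gt0.
Qed.

(** Otherwise the edge bi would pass through a, or the edge ai through b. *)
Lemma on_base i : i \in common -> Y i = 0 -> 0 < X i < 1.
Proof.
move=> /andP[ai bi] Yi0.
have ia := neq_adj ai; have ib := neq_adj bi.
apply/andP; split; rewrite ltNge; apply/negP => Xi.
  apply: (off_edge bi neq_ab ia).
  have X1 : 0 < 1 - X i by lra.
  apply: (@segment_b _ _ (1 - X i)^-1); rewrite ?Xa ?Ya ?Yi0 ?mulr0//.
    by rewrite invr_ge0 ltW//= invf_le1//; lra.
  by field; rewrite gt_eqF.
apply: (off_edge ai _ ib); first by rewrite eq_sym.
have X1 : 0 < X i by lra.
apply: (@segment_a _ _ (X i)^-1); rewrite ?Xb ?Yb ?Yi0 ?mulr0//.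
  by rewrite invr_ge0 ltW//= invf_le1//; lra.
by rewrite mulVf// gt_eqF.
Qed.

(** Of two such vertices, the one nearer to a would lie on the edge from a to the other. *)
Lemma on_base_unique i j :
  i \in common -> j \in common -> Y i = 0 -> Y j = 0 -> i = j.
Proof.
wlog : i j / X i <= X j => [W ci cj Yi Yj|Xij ci cj Yi Yj].
  by have [/W ->|/ltW/W ->] := leP (X i) (X j).
have /andP[Xi0 Xi1] := on_base ci Yi; have /andP[Xj0 Xj1] := on_base cj Yj.
apply/eqP/negP => /negP ij.
case/andP: ci => ai bi; case/andP: cj => aj bj.
apply: (off_edge aj _ ij); first by rewrite eq_sym neq_adj.
apply: (@segment_a _ _ (X i / X j)); rewrite ?Yi ?Yj ?mulr0//.
  by rewrite ler_pdivrMr// mul1r Xij divr_ge0// ltW.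
by rewrite divfK// gt_eqF.
Qed.

(** The edges ak and bk cover the base, so the whole boundary of the triangle of i is drawn. *)
Lemma base_enclosed i k v :
  i \in common -> k \in common -> Y i != 0 -> Y k = 0 ->
  ~ [/\ 0 < bary_apex i (f v), 0 < bary_b i (f v) & 0 < bary_a i (f v)].
Proof.
move=> ci ck Yi0 Yk [cv bv av].
apply: (@not_outer ([set p | 0 < bary_apex i p] `&` [set p | 0 < bary_b i p]
  `&` [set p | 0 < bary_a i p]) (tri i) v) => //.
- by apply: openI => //; exact: openI.
- by move=> p [[hc hb] ha]; split; exact: ltW.
- move=> p Tp; have [hc hb ha] := Tp.
  move: (hb); rewrite le_eqVlt eq_sym => /predU1P[b0|b_gt0].
    by right; apply: tri_edge Tp _ => //; left.
  move: (ha); rewrite le_eqVlt eq_sym => /predU1P[a0|a_gt0].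
    by right; apply: tri_edge Tp _ => //; right.
  move: (hc); rewrite le_eqVlt eq_sym => /predU1P[c0|c_gt0]; last by left.
  right; have /andP[X0 X1] := on_base ck Yk.
  have yp : yc p = 0 by rewrite -(divfK Yi0 (yc p)) -/(bary_apex i p) c0 mul0r.
  move: b_gt0 a_gt0; rewrite /bary_a /bary_b c0 mulr0 !subr0 => xp0 xp1.
  case/andP: ck => ak bk; have [xpk|xpk] := leP (xc p) (X k).
    apply: (drawn_edge ak); apply: (@segment_a _ _ (xc p / X k)).
    + by rewrite ler_pdivrMr// mul1r xpk divr_ge0// ltW.
    + by rewrite divfK// gt_eqF.
    + by rewrite yp Yk mulr0.
  apply: (drawn_edge bk); apply: (@segment_b _ _ ((1 - xc p) / (1 - X k))).
  + have X1' : 0 < 1 - X k by lra.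
    by rewrite ler_pdivrMr// divr_ge0 ?ltW//=; lra.
  + by field; rewrite subr_eq0 gt_eqF.
  + by rewrite yp Yk mulr0.
- apply: (@coord_bounded _ _ _ neq_fab _ (1 + `|X i| + `|Y i|)) => p.
  exact: tri_bounded.
Qed.

(** The region is the triangle of i minus that of k. It stays off the open base, where the
    coordinates for i and k agree, so its boundary lies on the edges at i and k. *)
Lemma nested_enclosed i k v :
  i \in common -> k \in common -> side i k ->
  ~ [/\ 0 < bary_apex i (f v), 0 < bary_b i (f v), 0 < bary_a i (f v)
      & bary_b k (f v) < 0 \/ bary_a k (f v) < 0].
Proof.
move=> ci ck sik [cv bv av inv].
have /norP[Yi0 Yk0] : ~~ ((Y i == 0) || (Y k == 0)) by rewrite -mulf_eq0 gt_eqF.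
apply: (@not_outer ([set p | 0 < bary_apex i p] `&` [set p | 0 < bary_b i p]
  `&` [set p | 0 < bary_a i p]
  `&` ([set p | 0 < - bary_b k p] `|` [set p | 0 < - bary_a k p]))
  (tri i `&` ([set p | 0 <= - bary_b k p] `|` [set p | 0 <= - bary_a k p])) v) => //.
- by apply: openI; [apply: openI => //; exact: openI|exact: openU].
- apply: closedI => //; apply: closedU; apply: closed_ge0.
    exact: (oppf_continuous (@bary_b_continuous k)).
  exact: (oppf_continuous (@bary_a_continuous k)).
- move=> p [[[hc hb] ha] hk]; split; first by split; exact: ltW.
  by case: hk => hk; [left|right]; exact: ltW.
- move=> p [Tp /= hk]; have [hc hb ha] := Tp.
  move: (hb); rewrite le_eqVlt eq_sym => /predU1P[b0|b_gt0].
    by right; apply: tri_edge Tp _ => //; left.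
  move: (ha); rewrite le_eqVlt eq_sym => /predU1P[a0|a_gt0].
    by right; apply: tri_edge Tp _ => //; right.
  move: (hc); rewrite le_eqVlt eq_sym => /predU1P[c0|c_gt0].
    have [_ eb ea] := bary_base k Yi0 c0.
    by case: hk; rewrite oppr_ge0 ?eb ?ea leNgt ?b_gt0 ?a_gt0.
  have ck_gt0 : 0 < bary_apex k p.
    by rewrite (bary_apex_ratio p Yi0 Yk0) mulr_gt0// divr_gt0_mul.
  have [bk|bk] := ltP (bary_b k p) 0; first by left; split => //; left; rewrite /= oppr_gt0.
  have [ak|ak] := ltP (bary_a k p) 0; first by left; split => //; right; rewrite /= oppr_gt0.
  right; apply: (tri_edge ck Yk0); first by split => //; exact: ltW.
  by case: hk; rewrite oppr_ge0 => hk; [left|right]; apply/eqP; rewrite eq_le hk.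
- apply: (@coord_bounded _ _ _ neq_fab _ (1 + `|X i| + `|Y i|)) => p [Tp _].
  exact: tri_bounded.
- by rewrite /= !oppr_gt0.
Qed.

(** * Nested and crossing pairs in terms of cotangents *)

Let sideE i j : side i j -> [/\ 0 < H i, 0 < H j & Y j / Y i = H j / H i].
Proof.
move=> sij.
have /norP[Yi0 Yj0] : ~~ ((Y i == 0) || (Y j == 0)) by rewrite -mulf_eq0 gt_eqF.
rewrite /H !normr_gt0; split => //; rewrite -normf_div ger0_norm// ltW//.
by rewrite divr_gt0_mul// mulrC.
Qed.

Let side_sym i j : side i j -> side j i. Proof. by rewrite /side mulrC. Qed.

Let XE i : H i != 0 -> X i = u i * H i. Proof. by move=> Hi0; rewrite divfK. Qed.
Let XbE i : H i != 0 -> 1 - X i = w i * H i. Proof. by move=> Hi0; rewrite divfK. Qed.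

(** Comparing cotangents thus decides whether j lies in the triangle of i. *)
Let bary_vertex i j : side i j ->
  [/\ 0 < bary_apex i (f j), bary_b i (f j) = H j * (u j - u i)
    & bary_a i (f j) = H j * (w j - w i)].
Proof.
move=> /sideE[Hi Hj e]; rewrite /bary_a /bary_b /bary_apex e /u /w.
split; first exact: divr_gt0.
  by field; rewrite !gt_eqF.
by field; rewrite !gt_eqF.
Qed.

(** Equal cotangents at a put i and j on one ray from a, and the edge to the higher vertex would
    pass through the lower one. The next lemma is the same at b. *)
Let u_inj i j : i \in common -> j \in common -> side i j -> u i = u j -> i = j.
Proof.
wlog Hij : i j / H i <= H j => [W ci cj sij uij|].
  have [/W ->//|/ltW/W ->//] := leP (H i) (H j); exact: side_sym.
move=> ci cj sij uij; apply/eqP/negP => /negP ij.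
have [Hi Hj /esym e] := sideE sij.
case/andP: ci => ai bi; case/andP: cj => aj bj.
apply: (off_edge aj _ ij); first by rewrite eq_sym neq_adj.
have Yi0 : Y i != 0 by rewrite -normr_gt0.
have Yj0 : Y j != 0 by rewrite -normr_gt0.
apply: (@segment_a _ _ (H i / H j)).
- by rewrite ler_pdivrMr// mul1r Hij divr_ge0// ltW.
- rewrite (XE (i := i)) ?gt_eqF// (XE (i := j)) ?gt_eqF// uij.
  by field; rewrite gt_eqF.
- by rewrite -invf_div e invf_div divfK.
Qed.

Let w_inj i j : i \in common -> j \in common -> side i j -> w i = w j -> i = j.
Proof.
wlog Hij : i j / H i <= H j => [W ci cj sij uij|].
  have [/W ->//|/ltW/W ->//] := leP (H i) (H j); exact: side_sym.
move=> ci cj sij wij; apply/eqP/negP => /negP ij.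
have [Hi Hj /esym e] := sideE sij.
case/andP: ci => ai bi; case/andP: cj => aj bj.
apply: (off_edge bj _ ij); first by rewrite eq_sym neq_adj.
have Yi0 : Y i != 0 by rewrite -normr_gt0.
have Yj0 : Y j != 0 by rewrite -normr_gt0.
apply: (@segment_b _ _ (H i / H j)).
- by rewrite ler_pdivrMr// mul1r Hij divr_ge0// ltW.
- have := XbE (i := i) (lt0r_neq0 Hi); rewrite wij /w => h.
  have -> : X i = 1 - (1 - X i) by ring.
  by rewrite h; field; rewrite gt_eqF.
- by rewrite -invf_div e invf_div divfK.
Qed.

(** Up to scaling, aj has direction (u_j, 1) and bi has direction (- w_i, 1). The edges meet, so the
    inner product 1 - u_j w_i vanishes. *)
Let crossing i j : i \in common -> j \in common -> side i j ->
  u i < u j -> w j < w i -> u j * w i = 1.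
Proof.
move=> /andP[ai bi] /andP[aj bj] sij uij wij.
have [Hi Hj e] := sideE sij.
have Hi0 := lt0r_neq0 Hi; have Hj0 := lt0r_neq0 Hj.
have Yi0 : Y i != 0 by rewrite -normr_gt0.
have [_ rac _] := f_drawing.
have sumH k : H k != 0 -> H k * (u k + w k) = 1.
  by move=> Hk; rewrite /u /w; field.
have sumj : 0 < u j + w j by rewrite -(pmulr_rgt0 _ Hj) sumH.
(* The height at which the lines aj and bi meet. Since u_k + w_k is the inverse of [H k], the
   hypotheses put [Z] below both [H i] and [H j], so the meeting point is inside both edges. *)
pose Z := (u j + w i)^-1.
have Zden : 0 < u j + w i by apply: lt_trans sumj _; rewrite ltrD2l.
have Z_gt0 : 0 < Z by rewrite invr_gt0.
have Zlt k : 0 < H k -> u k + w k < u j + w i -> 0 < Z / H k < 1.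
  move=> Hk lt; rewrite divr_gt0//= ltr_pdivrMr// mul1r.
  rewrite -[H k]invrK ltf_pV2 ?posrE ?invr_gt0//.
  by rewrite -[(H k)^-1]mul1r -(sumH k) ?gt_eqF// mulrAC divff ?gt_eqF// mul1r.
have YjE : Y j = H j / H i * Y i by rewrite -e divfK.
pose p := (1 - Z / H j) *: f a + (Z / H j) *: f j.
have px : xc p = Z * u j by rewrite (xcoord_comb neq_fab) Xa mulr0 add0r mulrAC -mulrA.
have py : yc p = Z / H i * Y i.
  by rewrite (ycoord_comb neq_fab) Ya mulr0 add0r YjE; field; rewrite Hi0 Hj0.
have perp : perpendicular (f j - f a) (f i - f b).
  apply: (rac a j b i aj bi).
    apply/eqP => /setP/(_ a); rewrite !inE eqxx (negbTE neq_ab) (negbTE (neq_adj ai)).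
    by [].
  exists p; split.
    exists (Z / H j) => //; rewrite /= in_itv/=.
    by apply: Zlt => //; rewrite ltrD2l.
  apply: (@open_segment_coord _ _ _ neq_fab (Z / H i)).
  - by apply: Zlt => //; rewrite ltrD2r.
  - rewrite px Xb mulr1.
    have -> : X i = 1 - w i * H i by rewrite -XbE//; ring.
    by rewrite /Z; field; rewrite Hi0 gt_eqF.
  - by rewrite py Yb mulr0 add0r.
have := perpendicular_coord neq_fab perp; rewrite Xa Ya Xb Yb !subr0 YjE.
have -> : X i - 1 = - (w i * H i) by rewrite -XbE//; ring.
have -> : H j / H i * Y i * Y i = H j * H i.
  have Y2 : Y i * Y i = H i * H i by rewrite /H -!expr2 real_normK// num_real.
  by rewrite -mulrA Y2; field.
rewrite (XE (i := j))// => h.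
apply: (mulfI (mulf_neq0 Hi0 Hj0)); rewrite mulr1; apply: subr0_eq.
by rewrite -oppr0 -h; ring.
Qed.

(** Both aj and ak would be perpendicular to bi, which forces u_j = u_k. *)
Let no_decreasing_triple i j k :
  i \in common -> j \in common -> k \in common -> side i j -> side i k ->
  u i < u j -> u j < u k -> w k < w j -> w j < w i -> False.
Proof.
move=> ci cj ck sij sik uij ujk wkj wji.
have eij := crossing ci cj sij uij wji.
have eik := crossing ci ck sik (lt_trans uij ujk) (lt_trans wkj wji).
have w0 : w i != 0 by apply: contra_eq_neq eij => ->; rewrite mulr0 eq_sym oner_eq0.
by move: ujk; rewrite (mulIf w0 (etrans eij (esym eik))) ltxx.
Qed.

(** The middle vertex j lies inside the triangle of i and outside that of k. *)
Let no_increasing_triple i j k :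
  i \in common -> k \in common -> side i j -> side i k -> side j k ->
  u i < u j -> u j < u k -> w i < w j -> w j < w k -> False.
Proof.
move=> ci ck sij sik sjk uij ujk wij wjk.
have [_ Hj _] := sideE sij.
have [apex_gt0 ebb eba] := bary_vertex sij.
have [_ ebbk _] := bary_vertex (side_sym sjk).
apply: (@nested_enclosed i k j) => //; rewrite ebb eba ebbk; split => //.
- by rewrite mulr_gt0// subr_gt0.
- by rewrite mulr_gt0// subr_gt0.
- by left; rewrite pmulr_rlt0// subr_lt0.
Qed.

(** The vertex j lies inside the triangle of i, which k closes off either along the base or as the
    opposite corner of a quadrilateral. *)
Let no_nested_pair i j k :
  i \in common -> k \in common -> side i j -> Y i * Y k <= 0 ->
  u i < u j -> w i < w j -> False.
Proof.
move=> ci ck sij sik uij wij.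
have [Hi Hj _] := sideE sij.
have Yi0 : Y i != 0 by rewrite -normr_gt0.
have [apex_gt0 ebb eba] := bary_vertex sij.
have bb_gt0 : 0 < bary_b i (f j) by rewrite ebb mulr_gt0// subr_gt0.
have ba_gt0 : 0 < bary_a i (f j) by rewrite eba mulr_gt0// subr_gt0.
have [Yk0|Yk0] := eqVneq (Y k) 0; first exact: (@base_enclosed i k j).
have sik_lt0 : Y i * Y k < 0 by rewrite lt_neqAle mulf_neq0.
apply: (@opposite_enclosed i k j) => //; split; [by right|left].
by rewrite (bary_apex_ratio _ Yi0 Yk0) pmulr_rlt0// divr_lt0_mul.
Qed.

(** Here j lies on the diagonal ab, inside the quadrilateral a i b k. *)
Let no_base_between i j k :
  i \in common -> j \in common -> k \in common ->
  Y j = 0 -> Y i * Y k < 0 -> False.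
Proof.
move=> ci cj ck Yj ik; have /andP[X0 X1] := on_base cj Yj.
apply: (@opposite_enclosed i k j) => //.
rewrite /bary_a /bary_b /bary_apex Yj !mul0r !mulr0 !subr0.
by rewrite subr_gt0 X0 X1; split; right.
Qed.

(** * Counting on one side of ab *)

Section OneSide.
Variable P : {set G}.
Hypothesis P_common : {in P, forall i, i \in common}.
Hypothesis P_side : {in P &, forall i j, side i j}.

(** The Erdos-Szekeres labels, one bit each as chains have at most two elements: whether i ends a
    crossing pair, and whether it ends a nested pair. *)
Let has_left_above i := [exists j in P, (u j < u i) && (w i < w j)].
Let has_left_below i := [exists j in P, (u j < u i) && (w j < w i)].

Let left_above_increasing i j : i \in P -> j \in P -> u i < u j ->
  has_left_above i = has_left_above j -> w i < w j.
Proof.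
move=> iP jP uij e; have [//||wij] := ltgtP (w i) (w j).
- move=> wji; have : has_left_above j by apply/exists_inP; exists i => //; rewrite uij.
  rewrite -e => /exists_inP[k kP /andP[uki wik]].
  by case: (@no_decreasing_triple k i j) => //; (exact: P_common || exact: P_side).
- by move: uij; rewrite (w_inj (P_common iP) (P_common jP) (P_side iP jP) wij) ltxx.
Qed.

(** The two bits determine the vertex: for equal labels, a crossing or nested pair i, j would extend
    on the left of i to a triple of the same kind. *)
Lemma one_side_le4 : (#|P| <= 4)%N.
Proof.
pose lab i := (has_left_above i, has_left_below i).
have lab_inj : {in P &, injective lab}.
  move=> i j; wlog : i j / u i <= u j => [W iP jP e|].
    by have [/W ->|/ltW/W ->] := leP (u i) (u j).
  rewrite le_eqVlt => /predU1P[uij|uij] iP jP [ea eb].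
    exact: u_inj (P_common iP) (P_common jP) (P_side iP jP) uij.
  have wij := left_above_increasing iP jP uij ea.
  have : has_left_below j by apply/exists_inP; exists i => //; rewrite uij.
  rewrite -eb => /exists_inP[k kP /andP[uki wki]].
  by case: (@no_increasing_triple k i j) => //; (exact: P_common || exact: P_side).
by rewrite -(card_in_imset lab_inj) (leq_trans (max_card _))// card_prod card_bool.
Qed.

(** Without nested pairs the first bit alone determines the vertex. *)
Lemma one_side_le2 k : k \in common ->
  {in P, forall i, Y i * Y k <= 0} -> (#|P| <= 2)%N.
Proof.
move=> ck Pk.
have lab_inj : {in P &, injective has_left_above}.
  move=> i j; wlog : i j / u i <= u j => [W iP jP e|].
    by have [/W ->|/ltW/W ->] := leP (u i) (u j).
  rewrite le_eqVlt => /predU1P[uij|uij] iP jP ea.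
    exact: u_inj (P_common iP) (P_common jP) (P_side iP jP) uij.
  have wij := left_above_increasing iP jP uij ea.
  case: (@no_nested_pair i j k) => //; [exact: P_common|exact: P_side|exact: Pk].
by rewrite -(card_in_imset lab_inj) (leq_trans (max_card _))// card_bool.
Qed.

End OneSide.

(** * Counting all common neighbours *)

(** One side alone holds at most 4, two sides at most 2 + 2, one side and the line at most 2 + 1;
    both sides and the line cannot all be occupied. *)
Lemma common_neighbours_le4 : (#|common| <= 4)%N.
Proof.
pose up := [set i in common | 0 < Y i]%SET.
pose low := [set i in common | Y i < 0]%SET.
pose mid := [set i in common | Y i == 0]%SET.
have upP i : i \in up -> i \in common /\ 0 < Y i by rewrite inE => /andP.
have lowP i : i \in low -> i \in common /\ Y i < 0 by rewrite inE => /andP.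
have midP i : i \in mid -> i \in common /\ Y i = 0 by rewrite inE => /andP[? /eqP].
have up_side : {in up &, forall i j, side i j}.
  by move=> i j /upP[_ Yi] /upP[_ Yj]; exact: mulr_gt0.
have low_side : {in low &, forall i j, side i j}.
  by move=> i j /lowP[_ Yi] /lowP[_ Yj]; rewrite /side nmulr_rgt0.
have up_common : {in up, forall i, i \in common} by move=> i /upP[].
have low_common : {in low, forall i, i \in common} by move=> i /lowP[].
have up_le k : k \in common -> Y k <= 0 -> (#|up| <= 2)%N.
  move=> ck Yk; apply: (one_side_le2 up_common up_side ck) => i /upP[_ Yi].
  by rewrite pmulr_rle0.
have low_le k : k \in common -> 0 <= Y k -> (#|low| <= 2)%N.
  move=> ck Yk; apply: (one_side_le2 low_common low_side ck) => i /lowP[_ Yi].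
  by rewrite nmulr_rle0.
have mid_le : (#|mid| <= 1)%N.
  apply/fintype.card_le1_eqP => i j /midP[ci Yi] /midP[cj Yj]; exact: on_base_unique.
have cardE : (#|common| <= #|up| + #|mid| + #|low|)%N.
  rewrite -(cardsE common); have -> : [set i in common]%SET = (up :|: mid :|: low)%SET.
    by apply/setP => i; rewrite !inE; case: ltgtP; rewrite ?andbT ?andbF ?orbF.
  by rewrite (leq_trans (leq_card_setU _ _))// leq_add2r leq_card_setU.
have [up0|[i iu]] := set_0Vmem up.
  have [mid0|[j jm]] := set_0Vmem mid.
    by rewrite (leq_trans cardE)// up0 mid0 !cards0 (one_side_le4 low_common low_side).
  have [cj Yj] := midP _ jm.
  rewrite (leq_trans cardE)// up0 cards0 add0n.
  by rewrite (leq_trans (leq_add mid_le (low_le _ cj _)))// Yj.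
have [ci Yi] := upP _ iu.
have [mid0|[j jm]] := set_0Vmem mid.
  have [low0|[k kl]] := set_0Vmem low.
    by rewrite (leq_trans cardE)// low0 mid0 !cards0 !addn0 (one_side_le4 up_common up_side).
  have [ck Yk] := lowP _ kl.
  rewrite (leq_trans cardE)// mid0 cards0 addn0.
  exact: leq_add (up_le _ ck (ltW Yk)) (low_le _ ci (ltW Yi)).
have [cj Yj] := midP _ jm.
have [low0|[k kl]] := set_0Vmem low.
  rewrite (leq_trans cardE)// low0 cards0 addn0.
  by rewrite (leq_trans (leq_add (up_le _ cj _) mid_le))// Yj.
have [ck Yk] := lowP _ kl.
by case: (no_base_between ci cj ck Yj); rewrite pmulr_rlt0.
Qed.

End CommonNeighbours.

End Drawings.

(** * The graph K_{2,5} *)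

Section K25.

(** The booleans are the two poles, and ['I_5] indexes their common neighbours. *)
Definition K25_adj (u v : bool + 'I_5) : bool :=
  match u, v with inl _, inr _ | inr _, inl _ => true | _, _ => false end.

Lemma K25_adj_sym : symmetric K25_adj. Proof. by case=> ? []. Qed.
Lemma K25_adj_irrefl : irreflexive K25_adj. Proof. by case. Qed.

Definition K25 : sgraph := SGraph K25_adj_sym K25_adj_irrefl.

Lemma K25_degree_pole s : @degree K25 (inl s) = 5%N.
Proof.
rewrite -[RHS](card_ord 5) -[RHS](fintype.card_image (@inr_inj bool 'I_5)).
apply: eq_card => -[t|i]; rewrite !inE /=; symmetry.
  by apply/fintype.imageP => -[].
by apply/fintype.imageP; exists i.
Qed.

Lemma K25_degree_inner i : @degree K25 (inr i) = 2%N.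
Proof.
rewrite -[RHS]card_bool -[RHS](fintype.card_image (@inl_inj bool 'I_5)).
apply: eq_card => -[t|j]; rewrite !inE /=; symmetry.
  by apply/fintype.imageP; exists t.
by apply/fintype.imageP => -[].
Qed.

Lemma K25_max_degree : max_degree K25 = 5%N.
Proof.
apply/eqP; rewrite eqn_leq; apply/andP; split.
  by apply/bigmax_leqP => -[s|i] _; rewrite ?K25_degree_pole ?K25_degree_inner.
by rewrite -(K25_degree_pole true); exact: leq_bigmax.
Qed.

(** Some pole and some inner vertex survive the removal of c; two vertices of one class are joined
    through a survivor of the other. *)
Lemma K25_avoiding_connect (c u v : K25) :
  u != c -> v != c -> connect (avoiding c) u v.
Proof.
have step x y : x != c -> y != c -> @adj K25 x y -> connect (avoiding c) x y.
  by move=> xc yc xy; apply/connect1/and3P.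
have [s sc] : exists s : bool, (inl s : K25) != c.
  by case: c {step} => [[]|i]; [exists false|exists true|exists true].
have [i ic] : exists i : 'I_5, (inr i : K25) != c.
  case: c {step sc} => [t|j]; first by exists ord0.
  exists (if j == ord0 then ord_max else ord0).
  by apply/eqP => -[] /eqP; case: (altP (j =P ord0)) => [->//|j0]; rewrite eq_sym (negbTE j0).
case: u => [u|u]; case: v => [v|v] uc vc.
- by apply: connect_trans (step _ (inr i) _ _ _) (step _ _ _ _ _).
- exact: step.
- exact: step.
- by apply: connect_trans (step _ (inl s) _ _ _) (step _ _ _ _ _).
Qed.

Lemma K25_not_outer_RAC (R : realType) : ~ outer_RAC R K25.
Proof.
move=> [f f_drawing].
have := common_neighbours_le4 f_drawing (isT : (inl true : K25) != inl false).
suff -> : #|[pred i : K25 | adj (inl true : K25) i && adj (inl false : K25) i]| = 5%N by [].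
by rewrite -[RHS](K25_degree_pole true); apply: eq_card => -[].
Qed.

(** A subdivision of K_4 needs four vertices of degree at least 3, but only the two poles have such
    a degree. *)
Lemma K25_series_parallel : series_parallel K25.
Proof.
split; first split.
- by rewrite card_sum card_bool card_ord.
- move=> u v.
  (* Connectedness follows from the connectedness without c, for any third vertex c. *)
  have [c /norP[cu cv]] : exists c : K25, ~~ ((c == u) || (c == v)).
    apply/existsP; rewrite -negb_forall; apply/negP => /forallP all_uv.
    have : #|[set: K25]| <= #|[set u; v]%SET|.
      by apply/subset_leq_card/fintype.subsetP => x _; rewrite !inE all_uv.
    by rewrite cardsT card_sum card_bool card_ord cards2; case: (u != v).
  have : connect (avoiding c) u v by apply: K25_avoiding_connect; rewrite eq_sym.
  by apply: connect_sub => x y /and3P[_ _ xy]; exact: connect1.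
- exact: K25_avoiding_connect.
move=> /K4_subdivision_degree[b b_inj b_deg].
have bP k : exists s, b k = inl s.
  by have := b_deg k; case: (b k) => [s|i]; [exists s|rewrite K25_degree_inner].
have : #|codom b| <= #|codom (fun s : bool => inl s : K25)|.
  apply/subset_leq_card/fintype.subsetP => _ /codomP[k ->].
  by have [s ->] := bP k; exact: codom_f.
by rewrite card_codom// card_codom ?card_ord ?card_bool//; exact: inl_inj.
Qed.

End K25.

Theorem theorem4 (R : realType) :
  exists G : sgraph,
    [/\ series_parallel G, max_degree G = 5 & ~ outer_RAC R G].
Proof.
exists K25; split.
- exact: K25_series_parallel.
- exact: K25_max_degree.
- exact: K25_not_outer_RAC.
Qed.
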